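(* Let $U_7^{14}=\{L(C)\in TLeib_7 : c_{2,3}=c_{1,2}=0,\ c_{1,1}\neq 0,\ c_{1,4}=0,\ c_{1,3}\neq 0\}$. 1. Two algebras $L(C)$ and $L(C')$ from $U_7^{14}$ are isomorphic if and only if $$\left(\frac{c'_{1,3}}{c'_{1,1}}\right)^4\left(4c'_{0,0}c'_{1,1}-{c'}_{0,1}^{2}\right)=\left(\frac{c_{1,3}}{c_{1,1}}\right)^4\left(4c_{0,0}c_{1,1}-c_{0,1}^2\right).$$ 2. For any $\lambda\in\mathbb{C}$ there exists $L(C)\in U_7^{14}$ with $\left(\frac{c_{1,3}}{c_{1,1}}\right)^4(4c_{0,0}c_{1,1}-c_{0,1}^2)=\lambda$. Moreover, the orbits (isomorphism classes) in $U_7^{14}$ are parameterized by the algebras $L(\lambda,0,1,0,1,0,0)$, $\lambda\in\mathbb{C}$: these algebras lie in $U_7^{14}$ and every algebra in $U_7^{14}$ is isomorphic to one of them.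
   Context: All algebras are over $\mathbb{C}$. For $C=(c_{0,0},c_{0,1},c_{1,1},c_{1,2},c_{1,3},c_{1,4},c_{2,3})\in\mathbb{C}^7$, $L(C)$ denotes the $7$-dimensional complex (Leibniz) algebra with basis $e_0,e_1,\dots,e_6$ and products (products of basis vectors not listed are zero): $[e_i,e_0]=e_{i+1}$ for $1\le i\le 5$; $[e_0,e_i]=-e_{i+1}$ for $2\le i\le 5$; $[e_0,e_0]=c_{0,0}e_6$; $[e_0,e_1]=-e_2+c_{0,1}e_6$; $[e_1,e_1]=c_{1,1}e_6$; $[e_1,e_2]=-[e_2,e_1]=c_{1,2}e_4+c_{1,3}e_5+c_{1,4}e_6$; $[e_1,e_3]=-[e_3,e_1]=c_{1,2}e_5+c_{1,3}e_6$; $[e_1,e_4]=-[e_4,e_1]=(c_{1,2}-c_{2,3})e_6$; $[e_2,e_3]=-[e_3,e_2]=c_{2,3}e_6$. $TLeib_7$ is the set of all $L(C)$, $C\in\mathbb{C}^7$. The entries of $C'$ are denoted $c'_{i,j}$, in the same order. ''Isomorphic'' means isomorphic as algebras over $\mathbb{C}$; an orbit is an isomorphism class. *)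

(* Defs.v *)
From HB Require Import structures.
From mathcomp Require Import all_boot all_order all_algebra.
From mathcomp Require Import classical_sets reals complex.

Set Implicit Arguments.
Unset Strict Implicit.
Unset Printing Implicit Defensive.

Import GRing.Theory.
Local Open Scope ring_scope.

(* A not necessarily associative algebra is a module with a bilinear law. *)
Definition isomorphic (K : fieldType) (V W : lmodType K)
    (m : {bilinear V -> V -> V}) (m' : {bilinear W -> W -> W}) : Prop :=
  exists f : {linear V -> W},
    bijective f /\ (forall x y : V, f (m x y) = m' (f x) (f y)).

Record params (K : Type) := Params {
  c00 : K; c01 : K; c11 : K; c12 : K; c13 : K; c14 : K; c23 : K }.

Definition e (K : fieldType) (k : nat) : 'rV[K]_7 := delta_mx 0 (inord k).

Definition basis_product (K : fieldType) (C : params K) (i j : nat) :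
    'rV[K]_7 :=
  match i, j with
  | 0%N, 0%N => c00 C *: e K 6%N
  | 0%N, 1%N => - e K 2%N + c01 C *: e K 6%N
  | 0%N, (2%N | 3%N | 4%N | 5%N) => - e K j.+1
  | (1%N | 2%N | 3%N | 4%N | 5%N), 0%N => e K i.+1
  | 1%N, 1%N => c11 C *: e K 6%N
  | 1%N, 2%N => c12 C *: e K 4%N + c13 C *: e K 5%N + c14 C *: e K 6%N
  | 2%N, 1%N => - (c12 C *: e K 4%N + c13 C *: e K 5%N + c14 C *: e K 6%N)
  | 1%N, 3%N => c12 C *: e K 5%N + c13 C *: e K 6%N
  | 3%N, 1%N => - (c12 C *: e K 5%N + c13 C *: e K 6%N)
  | 1%N, 4%N => (c12 C - c23 C) *: e K 6%N
  | 4%N, 1%N => - ((c12 C - c23 C) *: e K 6%N)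
  | 2%N, 3%N => c23 C *: e K 6%N
  | 3%N, 2%N => - (c23 C *: e K 6%N)
  | _, _ => 0
  end.

Definition bracket (K : fieldType) (C : params K) (x y : 'rV[K]_7) : 'rV[K]_7 :=
  \sum_(i < 7) \sum_(j < 7) (x 0 i * y 0 j) *: basis_product C i j.

Lemma bracket_is_bilinear (K : fieldType) (C : params K) :
  bilinear_for *:%R *:%R (bracket C).
Proof.
split=> [y|x] a u v /=; rewrite /bracket scaler_sumr -big_split; apply: eq_bigr => i _;
  rewrite scaler_sumr -big_split; apply: eq_bigr => j _ /=;
  rewrite scalerA -scalerDl !mxE.
  by rewrite mulrDl mulrA.
by rewrite mulrDr mulrCA.
Qed.

HB.instance Definition _ (K : fieldType) (C : params K) :=
  bilinear_isBilinear.Build K 'rV[K]_7 'rV[K]_7 'rV[K]_7 *:%R *:%R (bracket C)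
    (bracket_is_bilinear C).

(* Algebras on the fixed space K^7, that is bilinear laws on it. *)
Definition alg7 (K : fieldType) : Type :=
  {bilinear 'rV[K]_7 -> 'rV[K]_7 -> 'rV[K]_7}.

Definition L (K : fieldType) (C : params K) : alg7 K := bracket C.

Lemma L_basis (K : fieldType) (C : params K) (i j : nat) :
  (i < 7)%N -> (j < 7)%N -> L C (e K i) (e K j) = basis_product C i j.
Proof.
move=> lti ltj; rewrite /= /bracket (bigD1 (inord i)) //= (bigD1 (inord j)) //=.
rewrite !mxE !eqxx !inordK // mulr1 scale1r !big1 ?addr0 // => [i' /negPf ne|].
  by apply: big1 => j' _; rewrite !mxE ne andbF mul0r scale0r.
by move=> j' /negPf ne; rewrite !mxE ne andbF mulr0 scale0r.
Qed.

Definition U7_14 (K : fieldType) : set (alg7 K) :=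
  [set A | exists C : params K, A = L C /\
     [/\ c23 C = 0 /\ c12 C = 0, c11 C <> 0, c14 C = 0 & c13 C <> 0]]%classic.

Lemma L_inj (K : fieldType) (C C' : params K) :
  L C = L C' -> C = C'.
Proof.
move=> eqL.
have LE x y : L C x y = L C' x y.
  by rewrite eqL.
have E i j (k : 'I_7) : (i < 7)%N -> (j < 7)%N ->
    basis_product C i j 0 k = basis_product C' i j 0 k.
  by move=> lti ltj; rewrite -!L_basis // LE.
have iE i j : (i < 7)%N -> (j < 7)%N -> (inord i == inord j :> 'I_7) = (i == j).
  by move=> lti ltj; rewrite -val_eqE /= !inordK.
have := E 0%N 0%N (inord 6) isT isT; have := E 0%N 1%N (inord 6) isT isT.
have := E 1%N 1%N (inord 6) isT isT; have := E 1%N 2%N (inord 4) isT isT.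
have := E 1%N 2%N (inord 5) isT isT; have := E 1%N 2%N (inord 6) isT isT.
have := E 2%N 3%N (inord 6) isT isT.
rewrite /basis_product !mxE !iE //= !(oppr0, mulr0, mulr1, addr0, add0r).
case: C C' {eqL LE E} => [???????] [???????] /=.
by move=> -> -> -> -> -> -> ->.
Qed.

Lemma U7_14_L (K : fieldType) (C : params K) :
  U7_14 (L C) <->
  [/\ c23 C = 0 /\ c12 C = 0, c11 C <> 0, c14 C = 0 & c13 C <> 0].
Proof.
split=> [[C' [eqL]]|UC]; first by rewrite (L_inj eqL).
by exists C.
Qed.

(* Main.v *)
Require Import Defs.
From mathcomp Require Import all_boot all_order all_algebra.
From mathcomp Require Import classical_sets reals complex.
From mathcomp Require Import ring.

Set Implicit Arguments.
Unset Strict Implicit.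
Unset Printing Implicit Defensive.

Import GRing.Theory Num.Theory.
Local Open Scope ring_scope.

(** The quantity compared is an invariant because of how few isomorphisms there
    are.  Let [f : L C -> L C'] be an injective homomorphism, [x = f e_0] and
    [y = f e_1].  As [e_2 = [e_1, e_0]] and [e_(k+1) = [e_k, e_0]], the pair
    [x, y] determines [f], and [f e_6 = D x_0 ^ 4 e_6] with
    [D = y_1 x_0 - y_0 x_1]; so [D] and [x_0] are nonzero.  Then the coefficient
    of [e_3] in the relation [[e_2, e_1] = - c_13 e_5] gives [y_0 = 0], and with
    [s = x_0], [t = x_1], [u = y_1] the remaining relations say
    - [c_13 s^3 = c'_13 u]  and  [c_11 s^5 = c'_11 u],
    - [c_01 s^5 = c'_01 s + 2 c'_11 t],
    - [c_00 s^5 u = c'_00 s^2 + c'_01 s t + c'_11 t^2].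
    The last three say that the binary quadratic form
    [c'_00 X^2 + c'_01 X Y + c'_11 Y^2] becomes [s^5 u] times
    [c_00 X^2 + c_01 X Y + c_11 Y^2] under the substitution
    [(X, Y) := (s X, t X + u Y)].  Comparing discriminants,
    [4 c'_00 c'_11 - c'_01^2 = s^8 (4 c_00 c_11 - c_01^2)], while the first two
    give [c'_13 / c'_11 = s^-2 (c_13 / c_11)]; the fourth power in the invariant
    makes the powers of [s] cancel ([hom_base_change_eqs],
    [base_change_invariant]).

    Conversely any [s, t, u] with [s, u] nonzero satisfying these equations give
    an isomorphism ([base_change_isomorphic]), and if the invariants agree the
    equations can be solved: [s] is a square root, [u] and [t] are then given by
    the equations for [c_11] and [c_01], and the one for [c_00] follows from the
    equality of the invariants ([invariant_isomorphic]).  The representatives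
    [L(lambda, 0, 1, 0, 1, 0, 0)] have invariant [4 lambda], so each class
    contains exactly one of them. *)

(** * The bracket in coordinates *)

(** Lets [ring] prove an equation from an equational hypothesis. *)
Lemma eq_from_eq (V : zmodType) (l r a b : V) :
  l = r -> a - b = l - r -> a = b.
Proof. by move=> ->; rewrite subrr => /subr0_eq. Qed.

Definition coord (K : fieldType) (x : 'rV[K]_7) (k : nat) : K := x 0 (inord k).

Lemma coordP (K : fieldType) (x y : 'rV[K]_7) :
  (forall k, (k < 7)%N -> coord x k = coord y k) -> x = y.
Proof.
by move=> E; apply/rowP => k; have := E k (ltn_ord k); rewrite /coord inord_val.
Qed.

Lemma coordD (K : fieldType) (x y : 'rV[K]_7) k :
  coord (x + y) k = coord x k + coord y k.
Proof. by rewrite /coord mxE. Qed.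

Lemma coordN (K : fieldType) (x : 'rV[K]_7) k : coord (- x) k = - coord x k.
Proof. by rewrite /coord mxE. Qed.

Lemma coordZ (K : fieldType) (a : K) (x : 'rV[K]_7) k :
  coord (a *: x) k = a * coord x k.
Proof. by rewrite /coord mxE. Qed.

Lemma coord0 (K : fieldType) k : coord (0 : 'rV[K]_7) k = 0.
Proof. by rewrite /coord mxE. Qed.

Lemma coord_e (K : fieldType) i k : (i < 7)%N -> (k < 7)%N ->
  coord (e K i) k = (k == i)%:R.
Proof.
by move=> lti ltk; rewrite /coord mxE eqxx -val_eqE /= !inordK.
Qed.

Lemma sum_ord7 (V : nmodType) (F : nat -> V) :
  \sum_(i < 7) F i = F 0%N + F 1%N + F 2%N + F 3%N + F 4%N + F 5%N + F 6%N.
Proof.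
by rewrite !big_ord_recr big_ord0 /= add0r.
Qed.

Lemma bracketE (K : fieldType) (C : params K) (x y : 'rV[K]_7) :
  L C x y = \sum_(i < 7) \sum_(j < 7)
    (coord x i * coord y j) *: basis_product C i j.
Proof.
rewrite /L /= /bracket; apply: eq_bigr => i _; apply: eq_bigr => j _.
by rewrite /coord !inord_val.
Qed.

Definition sparse_params (K : fieldType) (C : params K) : Prop :=
  [/\ c12 C = 0, c14 C = 0 & c23 C = 0].

Definition bracket_coords (K : fieldType) (C : params K) (x y : nat -> K) :
    seq K :=
  [:: 0; 0;
      x 1%N * y 0%N - x 0%N * y 1%N;
      x 2%N * y 0%N - x 0%N * y 2%N;
      x 3%N * y 0%N - x 0%N * y 3%N;
      x 4%N * y 0%N - x 0%N * y 4%N + c13 C * (x 1%N * y 2%N - x 2%N * y 1%N);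
      x 5%N * y 0%N - x 0%N * y 5%N + c13 C * (x 1%N * y 3%N - x 3%N * y 1%N)
        + (c00 C * (x 0%N * y 0%N) + c01 C * (x 0%N * y 1%N) + c11 C * (x 1%N * y 1%N))].

Lemma coord_bracket (K : fieldType) (C : params K) (x y : 'rV[K]_7) k :
  sparse_params C -> (k < 7)%N ->
  coord (L C x y) k = nth 0 (bracket_coords C (coord x) (coord y)) k.
Proof.
case: C => a b c d12 d d14 d23 [/= -> -> ->] ltk; rewrite bracketE.
rewrite (sum_ord7 (fun i => \sum_(j < 7)
   (coord x i * coord y j) *: basis_product (Params a b c 0 d 0 0) i j)).
rewrite !(sum_ord7 (fun j => (coord x _ * coord y j) *:
   basis_product (Params a b c 0 d 0 0) _ j)).
rewrite /basis_product /=.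
rewrite !(coordD, coordZ, coordN, coord0, coord_e) //.
by case: k ltk => [|[|[|[|[|[|[|//]]]]]]] _ /=; ring.
Qed.

(** * Base changes *)

Definition base_change_eqs (K : fieldType) (C C' : params K) (s t u : K) :=
  [/\ c13 C * s ^+ 3 = c13 C' * u,
      c11 C * s ^+ 5 = c11 C' * u,
      c01 C * s ^+ 5 = c01 C' * s + 2 * c11 C' * t &
      c00 C * s ^+ 5 * u = c00 C' * s ^+ 2 + c01 C' * s * t + c11 C' * t ^+ 2].

Definition invariant (K : fieldType) (C : params K) : K :=
  (c13 C / c11 C) ^+ 4 * (4 * c00 C * c11 C - c01 C ^+ 2).

Lemma base_change_invariant (K : fieldType) (C C' : params K) (s t u : K) :
  s != 0 -> u != 0 -> c11 C != 0 -> c11 C' != 0 ->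
  base_change_eqs C C' s t u -> invariant C' = invariant C.
Proof.
case: C C' => a b c ? d ? ? [a' b' c' ? d' ? ?]; rewrite /invariant /=.
move=> s0 u0 c0 c'0 [/= Ed Ec Eb Ea].
have {}Ed : d' = d * s ^+ 3 / u by rewrite Ed mulfK.
have {}Ec : c' = c * s ^+ 5 / u by rewrite Ec mulfK.
have disc : (4 * a' * c' - b' ^+ 2) = s ^+ 8 * (4 * a * c - b ^+ 2).
  apply: (mulfI (expf_neq0 2 s0)).
  transitivity (4 * (a' * s ^+ 2 + b' * s * t + c' * t ^+ 2) * c'
                - (b' * s + 2 * c' * t) ^+ 2); first by ring.
  by rewrite -Ea -Eb Ec; field.
by rewrite disc Ed Ec; field; rewrite s0 c0 u0.
Qed.

(** Row [i] is the image of [e_i] when [e_0] and [e_1] are sent to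
    [s e_0 + t e_1] and [u e_1]; the other rows are forced by
    [e_2 = [e_1, e_0]] and [e_(k+1) = [e_k, e_0]]. *)
Definition base_change_mx (K : fieldType) (C' : params K) (s t u : K) : 'M[K]_7 :=
  \matrix_(i, j) nth 0 (nth [::]
    [:: [:: s; t];
        [:: 0; u];
        [:: 0; 0; s * u; 0; 0; 0; c11 C' * t * u];
        [:: 0; 0; 0; s ^+ 2 * u; 0; - (c13 C' * s * t * u)];
        [:: 0; 0; 0; 0; s ^+ 3 * u; 0; - (2 * c13 C' * s ^+ 2 * t * u)];
        [:: 0; 0; 0; 0; 0; s ^+ 4 * u];
        [:: 0; 0; 0; 0; 0; 0; s ^+ 5 * u]] i) j.

Lemma base_change_unit (K : fieldType) (C' : params K) (s t u : K) :
  s != 0 -> u != 0 -> base_change_mx C' s t u \in unitmx.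
Proof.
move=> s0 u0; rewrite unitmxE -det_tr det_trig; last first.
  apply/is_trig_mxP => -[i lti] [j ltj] /=; rewrite !mxE /=.
  by case: j ltj => [|[|[|[|[|[|[|//]]]]]]] _;
     case: i lti => [|[|[|[|[|[|[|//]]]]]]] _.
rewrite unitfE; apply/prodf_neq0 => -[i lti] _; rewrite !mxE /=.
by case: i lti => [|[|[|[|[|[|[|//]]]]]]] _ //=;
   rewrite mulf_neq0 ?expf_neq0.
Qed.

Lemma coord_base_change (K : fieldType) (C' : params K) (s t u : K)
    (x : 'rV[K]_7) k : (k < 7)%N ->
  coord (x *m base_change_mx C' s t u) k =
  let x := coord x in nth 0
    [:: x 0%N * s;
        x 0%N * t + x 1%N * u;
        x 2%N * (s * u);
        x 3%N * (s ^+ 2 * u);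
        x 4%N * (s ^+ 3 * u);
        x 5%N * (s ^+ 4 * u) - x 3%N * (c13 C' * s * t * u);
        x 6%N * (s ^+ 5 * u) + x 2%N * (c11 C' * t * u)
          - x 4%N * (2 * c13 C' * s ^+ 2 * t * u)] k.
Proof.
move=> ltk; rewrite {1}/coord mxE.
rewrite (eq_bigr (fun i : 'I_7 => coord x i *
    base_change_mx C' s t u (inord i) (inord k))); last first.
  by move=> i _; rewrite /coord !inord_val.
rewrite (sum_ord7 (fun i => coord x i *
    base_change_mx C' s t u (inord i) (inord k))) !mxE !inordK //.
by case: k ltk => [|[|[|[|[|[|[|//]]]]]]] _ /=; ring.
Qed.

Lemma base_change_isomorphic (K : fieldType) (C C' : params K) (s t u : K) :
  sparse_params C -> sparse_params C' -> s != 0 -> u != 0 ->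
  base_change_eqs C C' s t u -> isomorphic (L C) (L C').
Proof.
move=> SC SC' s0 u0 [Ed Ec Eb Ea].
have M1 := base_change_unit C' t s0 u0.
exists (mulmxr (base_change_mx C' s t u)); split=> [|x y /=].
  by exists (mulmxr (invmx (base_change_mx C' s t u))) => x /=;
     rewrite ?mulmxK ?mulmxKV.
apply: coordP => k ltk.
rewrite coord_base_change // coord_bracket // /bracket_coords.
have bE := coord_bracket x y SC; have gE z := coord_base_change C' s t u z.
rewrite !{}bE // !{}gE //.
case: k ltk => [|[|[|[|[|[|[|//]]]]]]] _ /=; try by ring.
  (* The two sides differ by a combination of the defects of the equations. *)
  apply: subr0_eq.
  transitivity ((coord x 1%N * coord y 2%N - coord x 2%N * coord y 1%N) * s * u
                * (c13 C * s ^+ 3 - c13 C' * u)); first by ring.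
  by rewrite Ed subrr mulr0.
apply: subr0_eq.
transitivity
  ((coord x 1%N * coord y 3%N - coord x 3%N * coord y 1%N) * s ^+ 2 * u
      * (c13 C * s ^+ 3 - c13 C' * u)
   + coord x 1%N * coord y 1%N * u * (c11 C * s ^+ 5 - c11 C' * u)
   + coord x 0%N * coord y 1%N * u
      * (c01 C * s ^+ 5 - (c01 C' * s + 2 * c11 C' * t))
   + coord x 0%N * coord y 0%N * (c00 C * s ^+ 5 * u
      - (c00 C' * s ^+ 2 + c01 C' * s * t + c11 C' * t ^+ 2))); first by ring.
by rewrite Ed Ec Eb Ea !subrr !mulr0 !addr0.
Qed.

(** * Homomorphisms are base changes *)

(** Although [f e_0 = x] and [f e_1 = y] have many free coordinates, only [x_0],
    [x_1], [y_1] enter the equations: in the relations for [e_0], [e_1] the others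
    cancel, the bracket being antisymmetric up to an [e_6]-valued form in the
    coordinates of index 0 and 1. *)
Lemma hom_base_change_eqs (K : fieldType) (C C' : params K)
    (f : {linear 'rV[K]_7 -> 'rV[K]_7}) :
  sparse_params C -> sparse_params C' -> injective f ->
  (forall x y, f (L C x y) = L C' (f x) (f y)) ->
  exists s t u, [/\ s != 0, u != 0 & base_change_eqs C C' s t u].
Proof.
move=> SC SC' injf fM; have [C12 C14 C23] := SC.
have fE i j k : (i < 7)%N -> (j < 7)%N -> (k < 7)%N ->
    coord (f (basis_product C i j)) k
    = nth 0 (bracket_coords C' (coord (f (e K i))) (coord (f (e K j)))) k.
  by move=> lti ltj ltk; rewrite -coord_bracket // -fM L_basis.
have e2E k (ltk : (k < 7)%N) := fE 1%N 0%N k isT isT ltk.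
have e3E k (ltk : (k < 7)%N) := fE 2%N 0%N k isT isT ltk.
have e4E k (ltk : (k < 7)%N) := fE 3%N 0%N k isT isT ltk.
have e5E k (ltk : (k < 7)%N) := fE 4%N 0%N k isT isT ltk.
have e6E k (ltk : (k < 7)%N) := fE 5%N 0%N k isT isT ltk.
rewrite /= in e2E e3E e4E e5E e6E.
set x := coord (f (e K 0%N)) in e2E e3E e4E e5E e6E.
set y := coord (f (e K 1%N)) in e2E.
pose D := y 1%N * x 0%N - y 0%N * x 1%N.
have f6 : f (e K 6%N) = (D * x 0%N ^+ 4) *: e K 6%N.
  apply: coordP => k ltk; rewrite coordZ coord_e // e6E // /D.
  case: k ltk => [|[|[|[|[|[|[|//]]]]]]] _ /=;
    do 4 rewrite ?e5E ?e4E ?e3E ?e2E //=; ring.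
have : D * x 0%N ^+ 4 != 0.
  apply/eqP => D0.
  have : e K 6%N = 0 by apply: injf; rewrite f6 D0 scale0r linear0.
  move/(congr1 (fun v => coord v 6%N)); rewrite coord_e // coord0 /= => /eqP.
  by rewrite oner_eq0.
rewrite mulf_eq0 negb_or expf_eq0 /= => /andP[D0 x0].
(* The relation [[e_2, e_1] = - c_13 e_5], read off the coefficient of [e_3]. *)
have y0 : y 0%N = 0.
  have := fE 2%N 1%N 3%N isT isT isT.
  rewrite /= C12 C14 !scale0r add0r addr0 linearN linearZ coordN coordZ.
  rewrite -/y; do 4 rewrite ?e5E ?e4E ?e3E ?e2E //=.
  by move=> E; apply: (mulfI D0); apply: (eq_from_eq (esym E)); rewrite /D; ring.
have DE : D = y 1%N * x 0%N by rewrite /D y0; ring.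
have u0 : y 1%N != 0 by apply: contraNneq D0 => y1; rewrite DE y1 mul0r.
have c6 : coord (f (e K 6%N)) 6%N = x 0%N ^+ 5 * y 1%N.
  by rewrite f6 coordZ coord_e //= DE; ring.
exists (x 0%N), (x 1%N), (y 1%N); split=> //; split.
- have := fE 2%N 1%N 5%N isT isT isT.
  rewrite /= C12 C14 !scale0r add0r addr0 linearN linearZ coordN coordZ -/y.
  do 4 rewrite ?e5E ?e4E ?e3E ?e2E //=.
  rewrite y0 => E; apply: (mulfI D0); rewrite DE.
  by apply: (eq_from_eq (esym E)); ring.
- have := fE 1%N 1%N 6%N isT isT isT.
  rewrite /= linearZ coordZ /= c6 -/y => E.
  by apply: (mulIf u0); apply: (eq_from_eq E); rewrite y0; ring.
- have := fE 0%N 1%N 6%N isT isT isT.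
  rewrite /= linearD linearN linearZ coordD coordN coordZ /= c6 e2E //= -/x -/y.
  by move=> E; apply: (mulIf u0); apply: (eq_from_eq E); rewrite y0; ring.
- have := fE 0%N 0%N 6%N isT isT isT.
  rewrite /= linearZ coordZ /= c6 -/x => E.
  by apply: (eq_from_eq E); ring.
Qed.

(** * Classification *)

Lemma U7_14P (K : fieldType) (C : params K) :
  U7_14 (L C) -> [/\ sparse_params C, c11 C != 0 & c13 C != 0].
Proof.
by move=> /U7_14_L[[C23 C12] /eqP C11 C14 /eqP C13].
Qed.

(** The equations for [c_13] and [c_11] force the square of [s], hence the
    need for a square root. *)
Lemma invariant_isomorphic (F : numClosedFieldType) (C C' : params F) :
  U7_14 (L C) -> U7_14 (L C') -> invariant C' = invariant C ->
  isomorphic (L C) (L C').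
Proof.
move=> /U7_14P[SC c0 d0] /U7_14P[SC' c'0 d'0] Einv.
have two0 : 2 != 0 :> F by rewrite pnatr_eq0.
have four0 : 4 != 0 :> F by rewrite pnatr_eq0.
case: C C' SC SC' c0 d0 c'0 d'0 Einv => a b c ? d ? ? [a' b' c' ? d' ? ?].
rewrite /invariant /= => SC SC' c0 d0 c'0 d'0 Einv.
pose q := (d / c) / (d' / c'); pose s := sqrtC q.
have q0 : q != 0 by rewrite !mulf_neq0 ?invr_eq0 ?mulf_neq0 ?invr_eq0.
have s2 : s ^+ 2 = q by rewrite sqrtCK.
have s0 : s != 0 by rewrite sqrtC_eq0.
pose u := c * s ^+ 5 / c'; pose t := (b * s ^+ 5 - b' * s) / (2 * c').
have u0 : u != 0 by rewrite !mulf_neq0 ?expf_neq0 ?invr_eq0.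
have disc : 4 * a' * c' - b' ^+ 2 = s ^+ 8 * (4 * a * c - b ^+ 2).
  have dc0 : (d' / c') ^+ 4 != 0 by rewrite expf_neq0 ?mulf_neq0 ?invr_eq0.
  apply: (mulfI dc0); rewrite Einv (exprM s 2 4) s2 /q.
  by field; rewrite c0 c'0 d'0.
apply: (@base_change_isomorphic _ _ _ s t u) => //; split=> /=.
- transitivity (d' * c / c' * s ^+ 2 * s ^+ 3); last by rewrite /u; field.
  by rewrite s2 /q; field; rewrite c0 c'0 d'0.
- by rewrite /u; field.
- by rewrite /t; field; rewrite c'0.
- apply: (mulfI (mulf_neq0 four0 c'0)).
  transitivity (4 * a * c * s ^+ 10); first by rewrite /u; field.
  (* Completing the square in the quadratic form [(c'_00, c'_01, c'_11)]. *)
  transitivity (s ^+ 2 * (4 * a' * c' - b' ^+ 2) + (b' * s + 2 * c' * t) ^+ 2);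
    last by ring.
  by rewrite disc /t; field; rewrite c'0.
Qed.

Lemma isomorphic_invariant (K : fieldType) (C C' : params K) :
  U7_14 (L C) -> U7_14 (L C') -> isomorphic (L C) (L C') ->
  invariant C' = invariant C.
Proof.
move=> /U7_14P[SC c0 _] /U7_14P[SC' c'0 _] [f [bijf fM]].
have [s [t [u [s0 u0 E]]]] := hom_base_change_eqs SC SC' (bij_inj bijf) fM.
exact: base_change_invariant s0 u0 c0 c'0 E.
Qed.

Lemma representative_U7_14 (K : fieldType) (lambda : K) :
  U7_14 (L (Params lambda 0 1 0 1 0 0)).
Proof.
by apply/U7_14_L; split=> //=; apply/eqP; rewrite oner_eq0.
Qed.

Lemma invariant_representative (K : fieldType) (lambda : K) :
  invariant (Params lambda 0 1 0 1 0 0) = 4 * lambda.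
Proof. by rewrite /invariant /= divr1; ring. Qed.

Theorem proposition2p10 (R : realType) :
  [/\ forall C C' : params R[i],
        U7_14 (L C) -> U7_14 (L C') ->
        (isomorphic (L C) (L C') <->
           (c13 C' / c11 C') ^+ 4 * (4 * c00 C' * c11 C' - c01 C' ^+ 2) =
           (c13 C / c11 C) ^+ 4 * (4 * c00 C * c11 C - c01 C ^+ 2)),
      forall lambda : R[i], exists C : params R[i],
        U7_14 (L C) /\
        (c13 C / c11 C) ^+ 4 * (4 * c00 C * c11 C - c01 C ^+ 2) = lambda,
      forall lambda : R[i], U7_14 (L (Params lambda 0 1 0 1 0 0)) &
      forall A : alg7 R[i], U7_14 A ->
        exists! lambda : R[i], isomorphic A (L (Params lambda 0 1 0 1 0 0))].
Proof.
have four0 : 4 != 0 :> R[i] by rewrite pnatr_eq0.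
split=> [C C' UC UC'|lambda|lambda|A UA].
- rewrite -/(invariant C) -/(invariant C'); split.
    exact: isomorphic_invariant UC UC'.
  exact: invariant_isomorphic UC UC'.
- exists (Params (lambda / 4) 0 1 0 1 0 0); split.
    exact: representative_U7_14.
  by rewrite -/(invariant _) invariant_representative mulrC divfK.
- exact: representative_U7_14.
- have [C [AE _]] := UA; rewrite {}AE in UA *.
  exists (invariant C / 4); split=> [|mu iso].
    apply: (invariant_isomorphic UA (representative_U7_14 _)).
    by rewrite invariant_representative mulrC divfK.
  rewrite -(isomorphic_invariant UA (representative_U7_14 mu) iso).
  by rewrite invariant_representative mulrAC divff // mul1r.
Qed.
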